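(* Let $p,q$ be multiplicatively independent integers with $1<p<q$, let $m$ be a positive integer, let $\rho=\log q/\log p$, and let $(b_i)_{i\in\mathbb{N}}$, $(K_n)_{n\in\mathbb{N}}$, $k_{2s}$, $k_{2s,t}$, $a_s$, $\varepsilon_s$ be as defined in the context. For all $i\ge 0$, let $d_{i+1}=b_{i+1}-b_i$. The sequence $(d_i)_{i\ge1}$ is non-decreasing; its terms all belong to $(K_n)_{n\in\mathbb{N}}$ and satisfy the following properties: (i) For each $s\in\mathbb{N}$, there exists at most one value of $t$ in $(0,a_{2s+2})$ such that $k_{2s,t}$ belongs to $(d_i)_{i\ge1}$. If $d_{i+1}=k_{2s,t}$ with $0<t<a_{2s+2}$, then $t=t_s$ is given by $$t_s=\left\lceil\frac{\varepsilon_{2s}-\{\log_p m-b_i\rho\}}{\varepsilon_{2s+1}}\right\rceil .$$ (ii) If $d_{i+1}=k_{2s}$ with either $i=0$ or $d_{i+1}>d_i$, then $k_{2s}$ occurs $n_s$ consecutive times in $(d_i)_{i\ge1}$, where $$n_s=\left\lfloor\frac{\{\log_p m-b_i\rho\}}{\varepsilon_{2s}}\right\rfloor .$$ Moreover, if either $s=0$ or $d_i=k_{2s-2,t}$ with $0<t<a_{2s}$, then $n_s\le a_{2s+1}$, else $n_s\le 1+a_{2s+1}$.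
   Context: $\mathbb{N}=\{0,1,2,\dots\}$; $p,q>1$ are multiplicatively independent if they are not powers of the same integer, equivalently $\rho=\log q/\log p$ is irrational. $\{x\}=x-\lfloor x\rfloor$ denotes the fractional part of a real $x$. Sequence $(b_i)_{i\in\mathbb{N}}$: for any $b\in\mathbb{N}$ let $\zeta(b)=p^{\lfloor\log_p m-b\rho\rfloor}q^b$. Put $b_0=0$ and, for $i\ge0$, $b_{i+1}=\min\{b\in\mathbb{N}: b>b_i \text{ and } \zeta(b)>\zeta(b_i)\}$. Continued fraction notation: $[a_0,a_1,a_2,\dots]$ is the regular continued fraction expansion of $\rho$, and for $s\ge0$, $h_s/k_s$ is its $s$-th principal convergent (so $k_0=1$, $k_1=a_1$, $k_{s+2}=a_{s+2}k_{s+1}+k_s$). Put $\varepsilon_s=|k_s\rho-h_s|$. For $s\ge0$ and $0\le t<a_{2s+2}$ let $k_{2s,t}=k_{2s}+t\,k_{2s+1}$ (so $k_{2s,0}=k_{2s}$); for $0<t<a_{2s+2}$ these are the denominators of the intermediate convergents (mediants) of $h_{2s}/k_{2s}$. $(H_n/K_n)_{n\in\mathbb{N}}$ is the increasing sequence of all convergents of $\rho$ of even index together with their intermediate convergents, so $(K_n)_{n\in\mathbb{N}}$ is the sequence of the integers $k_{2s,t}$ with $s\ge0$, $0\le t<a_{2s+2}$. *)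

(* Defs.v *)
From HB Require Import structures.
From mathcomp Require Import all_boot all_order all_algebra.
From mathcomp Require Import boolp reals exp.

Set Implicit Arguments.
Unset Strict Implicit.
Unset Printing Implicit Defensive.

Import Order.TTheory GRing.Theory Num.Theory.

Local Open Scope ring_scope.

Definition mult_independent (p q : nat) : Prop :=
  ~ exists n u v : nat, p = (n ^ u)%N /\ q = (n ^ v)%N.

Definition frac_part (R : realType) (x : R) : R := x - (Num.floor x)%:~R.

Definition logb (R : realType) (p : nat) (x : R) : R := ln x / ln p%:R.

Definition log_ratio (R : realType) (p q : nat) : R := ln q%:R / ln p%:R.

(* If x is irrational, no cf_rest x n is an integer, so that the expansion
   never ends and 0^-1 = 0 plays no role. *)
Fixpoint cf_rest (R : realType) (x : R) (n : nat) : R :=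
  if n is n'.+1 then (frac_part (cf_rest x n'))^-1 else x.

Definition cf_quot (R : realType) (x : R) (n : nat) : int :=
  Num.floor (cf_rest x n).

Fixpoint cf_num (R : realType) (x : R) (n : nat) : int :=
  match n with
  | 0 => cf_quot x 0
  | n1.+1 =>
      match n1 with
      | 0 => cf_quot x 1 * cf_quot x 0 + 1
      | n2.+1 => cf_quot x n * cf_num x n1 + cf_num x n2
      end
  end.

Fixpoint cf_den (R : realType) (x : R) (n : nat) : int :=
  match n with
  | 0 => 1
  | n1.+1 =>
      match n1 with
      | 0 => cf_quot x 1
      | n2.+1 => cf_quot x n * cf_den x n1 + cf_den x n2
      end
  end.

Definition cf_err (R : realType) (x : R) (s : nat) : R :=
  `|(cf_den x s)%:~R * x - (cf_num x s)%:~R|.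

(* k_{2s,t} = k_{2s} + t k_{2s+1} *)
Definition cf_mediant_den (R : realType) (x : R) (s : nat) (t : int) : int :=
  cf_den x (2 * s) + t * cf_den x (2 * s + 1).

(* The set of terms of the sequence (K_n). *)
Definition lower_den (R : realType) (x : R) (k : int) : Prop :=
  exists (s : nat) (t : int),
    0 <= t < cf_quot x (2 * s + 2) /\ k = cf_mediant_den x s t.

(* The exponent of p is negative when p does not occur in the best
   approximation of m with b factors q, i.e. when m < q ^ b: z is an integer
   power in R. *)
Definition zeta (R : realType) (p q m b : nat) : R :=
  p%:R ^ Num.floor (logb p m%:R - b%:R * log_ratio R p q) * q%:R ^+ b.

Definition next_exponent (R : realType) (p q m b : nat) : option nat :=
  if pselect (exists b' : nat,
                (b < b')%N && (zeta R p q m b < zeta R p q m b'))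
  is left ex then Some (ex_minn ex) else None.

(* The sequence is finite exactly when zeta reaches the value m, which happens
   when m = p ^ a * q ^ b for some integer a and natural number b: the minimum
   defining the next term is then taken over the empty set.  The indices past
   the last term are mapped to None. *)
Fixpoint exponent (R : realType) (p q m i : nat) : option nat :=
  if i is j.+1 then
    if exponent R p q m j is Some b then next_exponent R p q m b else None
  else Some 0%N.

(* Indexed from 1: gap 0 = None, and gap i.+1 is b_{i+1} - b_i if b_{i+1}
   exists. *)
Definition gap (R : realType) (p q m i : nat) : option int :=
  if i is j.+1 then
    match exponent R p q m j, exponent R p q m j.+1 with
    | Some b, Some b' => Some (b'%:Z - b%:Z)
    | _, _ => None
    end
  else None.

(* Main.v *)
Require Import Defs.
From HB Require Import structures.
From mathcomp Require Import all_boot all_order all_algebra.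
From mathcomp Require Import boolp reals exp.
From mathcomp Require Import ring lra zify.

(** Write [rho = log q / log p] and call [f(b) = {log_p m - b rho}] the level
    of [b]; it is the logarithm in base [p] of [m / zeta(b)], so [zeta]
    increases exactly when the level decreases.  Subtracting [d rho] from a
    real of fractional part [y] lowers that fractional part if and only if
    [{d rho} <= y], and then by exactly [{d rho}].  Hence the sequence is a
    greedy descent: from the level [y], the next difference is the least
    [d > 0] with [{d rho} <= y] ([first_below]), and the new level is
    [y - {d rho}] ([next_exponentP], [gapP]).  Levels decrease, so the
    differences do not.

    What is left is a question on best approximations of [rho] from below.  Let
    [E_{s,t} = eps_{2s} - t eps_{2s+1}], which is [{k_{2s,t} rho}].  A lattice
    argument ([mediant_best_lower]) shows that every positive [d] smaller than
    the denominator following [k_{2s,t}] in [(K_n)] has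
    [{d rho} >= E_{s,t}].  Therefore a step is always some [k_{2s,t}], and it
    is that one when the level lies in the interval
    [E_{s,t} <= y < E_{s,t-1}] ([first_below_mediant]); for a mediant, this
    double inequality is the formula for [t_s].

    After a mediant step the level is below
    [E_{s,t-1} - E_{s,t} = eps_{2s+1}], too low for any other mediant of the
    same [s].  A step [k_{2s}] is repeated as long as the level stays at or
    above [eps_{2s}], which gives [n_s] as the integral part of
    [y / eps_{2s}].  The bounds on [n_s] come from those on [y]: [y < 1] if
    [s = 0], [y < eps_{2s-1}] after a mediant step, and
    [y < E_{s-1,a-1} = eps_{2s} + eps_{2s-1}] with [a = a_{2s}] otherwise; one
    expands [1 = a_1 eps_0 + eps_1] or
    [eps_{2s-1} = a_{2s+1} eps_{2s} + eps_{2s+1}]. *)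

Set Implicit Arguments.
Unset Strict Implicit.
Unset Printing Implicit Defensive.

Import Order.TTheory GRing.Theory Num.Theory.

Local Open Scope ring_scope.

(** * Fractional parts *)

Lemma frac_part_bounds (R : realType) (x : R) : 0 <= frac_part x < 1.
Proof.
by rewrite /frac_part; have := floor_itv x; rewrite rmorphD /=; lra.
Qed.

Lemma frac_part_def (R : realType) (x y : R) (n : int) :
  x = n%:~R + y -> 0 <= y < 1 -> frac_part x = y.
Proof.
move=> -> hy; rewrite /frac_part (@floor_def _ _ n); last first.
  by rewrite rmorphD /=; lra.
by ring.
Qed.

Lemma frac_part_sub (R : realType) (x y : R) :
  frac_part y <= frac_part x -> frac_part (x - y) = frac_part x - frac_part y.
Proof.
move=> hyx; apply: (@frac_part_def _ _ _ (Num.floor x - Num.floor y)).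
  by rewrite rmorphB /= /frac_part; ring.
by have := frac_part_bounds x; have := frac_part_bounds y; lra.
Qed.

(** When [{y} > {x}], the subtraction wraps around and [{x - y}] is
    [{x} - {y} + 1], at least [{x}]. *)
Lemma frac_part_sub_lt (R : realType) (x y : R) : 0 < frac_part y ->
  (frac_part (x - y) < frac_part x) = (frac_part y <= frac_part x).
Proof.
move=> hy; case: (lerP (frac_part y) (frac_part x)) => hyx; first by rewrite frac_part_sub // ltrBlDr ltrDl.
apply/negbTE; rewrite -leNgt.
have -> : frac_part (x - y) = frac_part x - frac_part y + 1.
  apply: (@frac_part_def _ _ _ (Num.floor x - Num.floor y - 1)).
    by rewrite !rmorphB /= /frac_part; ring.
  by have := frac_part_bounds x; have := frac_part_bounds y; lra.
by have := frac_part_bounds y; lra.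
Qed.

(** * Irrationality of log q / log p *)

(** Without division, this passes from [x] to [(x - n)^-1] by clearing
    denominators. *)
Definition irrational (R : realType) (x : R) : Prop :=
  forall k h : int, k%:~R * x = h%:~R -> k = 0.

Lemma frac_part_mul_gt0 (R : realType) (x : R) (k : int) :
  irrational x -> k != 0 -> 0 < frac_part (k%:~R * x).
Proof.
move=> irr_x /eqP k0; rewrite lt_def; case/andP: (frac_part_bounds (k%:~R * x)).
move=> -> _; rewrite andbT; apply/eqP => h0; apply: k0.
by apply: (irr_x k (Num.floor (k%:~R * x))); move: h0; rewrite /frac_part; lra.
Qed.

Lemma frac_part_irr_gt0 (R : realType) (x : R) :
  irrational x -> 0 < frac_part x.
Proof. by move=> irr_x; rewrite -[x]mul1r; apply: (@frac_part_mul_gt0 _ _ 1). Qed.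

(** If [q ^ k = p ^ h] with [h], [k] coprime, a Bezout relation [h u - k v = 1]
    makes [n = q ^ u / p ^ v] a common base: [p = n ^ k] and [q = n ^ h]. *)
Lemma common_base (p q h k : nat) : (0 < p)%N -> (0 < h)%N -> (0 < k)%N ->
  (p ^ h = q ^ k)%N -> exists n u v : nat, p = (n ^ u)%N /\ q = (n ^ v)%N.
Proof.
move=> p0 h0 k0 e.
have [g0 [dh dk]] : (0 < gcdn h k)%N /\ (gcdn h k %| h /\ gcdn h k %| k)%N.
  by rewrite gcdn_gt0 h0 dvdn_gcdl dvdn_gcdr.
set g := gcdn h k in g0 dh dk.
pose h' := (h %/ g)%N; pose k' := (k %/ g)%N.
have eh : h = (h' * g)%N by rewrite divnK.
have ek : k = (k' * g)%N by rewrite divnK.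
have h'0 : (0 < h')%N by move: h0; rewrite eh muln_gt0 => /andP[].
have k'0 : (0 < k')%N by move: k0; rewrite ek muln_gt0 => /andP[].
have e' : (p ^ h' = q ^ k')%N.
  by apply: (expIn g0); rewrite -!expnM -eh -ek.
have cop : gcdn h' k' = 1%N.
  have : (gcdn h' k' * g = 1 * g)%N by rewrite muln_gcdl -eh -ek mul1n.
  by move/eqP; rewrite eqn_pmul2r // => /eqP.
case: (egcdnP k' h'0) => u v; rewrite cop => bez _.
have e2 : ((p ^ v) ^ k' * p = (q ^ u) ^ k')%N.
  by rewrite -!expnM -[X in (_ * X)%N]expn1 -expnD -bez mulnC expnM e' -expnM mulnC.
have dv : (p ^ v %| q ^ u)%N.
  by rewrite -(dvdn_pexp2r _ _ k'0) -e2 dvdn_mulr.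
pose n := (q ^ u %/ p ^ v)%N.
have pn : p = (n ^ k')%N.
  have : ((p ^ v) ^ k' * p = (p ^ v) ^ k' * n ^ k')%N.
    by rewrite e2 -expnMn [(p ^ v * n)%N]mulnC divnK.
  by move/eqP; rewrite eqn_pmul2l ?expn_gt0 ?p0 // => /eqP.
exists n, k', h'; split=> //.
by apply: (expIn k'0); rewrite -e' {1}pn -!expnM mulnC.
Qed.

Lemma log_ratio_irrational (R : realType) (p q : nat) :
  (1 < p)%N -> (p < q)%N -> mult_independent p q ->
  irrational (log_ratio R p q).
Proof.
move=> p1 pq ind; have q1 := ltn_trans p1 pq.
have lnp : 0 < ln p%:R :> R by rewrite ln_gt0 // ltr1n.
have lnq : 0 < ln q%:R :> R by rewrite ln_gt0 // ltr1n.
have nat_case (k h : nat) : (0 < k)%N -> k%:R * log_ratio R p q = h%:R -> False.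
  move=> k0; rewrite /log_ratio => e.
  have e1 : k%:R * ln q%:R = h%:R * ln p%:R :> R.
    by rewrite -e mulrA divfK // gt_eqF.
  have h0 : (0 < h)%N.
    rewrite -(ltr0n R) -(pmulr_lgt0 _ lnp) -e1.
    by rewrite pmulr_rgt0 // ltr0n.
  apply: ind; apply: (@common_base p q h k) => //; first exact: ltnW.
  have pow_gt0 (a b : nat) : (1 < a)%N -> 0 < a%:R ^+ b :> R.
    by move=> a1; rewrite exprn_gt0 // ltr0n ltnW.
  apply/eqP; rewrite -(eqr_nat R) !natrX; apply/eqP.
  apply: ln_inj; rewrite ?posrE ?pow_gt0 //.
  rewrite !lnXn ?ltr0n ?(ltnW p1) ?(ltnW q1) //.
  by rewrite -[ln p%:R *+ _]mulr_natl -[ln q%:R *+ _]mulr_natl.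
move=> k h.
have rho0 : 0 < log_ratio R p q by rewrite divr_gt0.
wlog k0 : k h / 0 < k.
  move=> W e; case: (ltgtP k 0) => // k0.
    by apply/eqP; rewrite -oppr_eq0; apply/eqP; apply: (W (- k) (- h));
      [rewrite oppr_gt0 | rewrite !rmorphN /= mulNr e].
  exact: (W k h).
move=> e; exfalso; have h0 : 0 < h.
  by rewrite -(ltr0z R) -e mulr_gt0 // ltr0z.
apply: (@nat_case `|k|%N `|h|%N); first by rewrite absz_gt0 gt_eqF.
by rewrite -[_%:R]/((Posz `|k|%N)%:~R) -[X in _ = X]/((Posz `|h|%N)%:~R)
  !gez0_abs // ltW.
Qed.

(** * Continued fractions of irrational numbers *)

Lemma cf_rest_irrational (R : realType) (x : R) (n : nat) :
  irrational x -> irrational (cf_rest x n).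
Proof.
move=> irr_x; elim: n => //= n IH k h e.
have f0 := frac_part_irr_gt0 IH.
have e1 : h%:~R * cf_rest x n = (k + h * Num.floor (cf_rest x n))%:~R.
  rewrite rmorphD rmorphM /= -[X in _ = X + _](divfK (lt0r_neq0 f0)) e.
  by rewrite /frac_part; ring.
move/eqP: e; rewrite (IH _ _ e1) mulf_eq0 invr_eq0 (gt_eqF f0) orbF intr_eq0.
by move/eqP.
Qed.

Lemma cf_rest_frac_gt0 (R : realType) (x : R) (n : nat) :
  irrational x -> 0 < frac_part (cf_rest x n).
Proof. by move=> irr_x; apply/frac_part_irr_gt0/cf_rest_irrational. Qed.

Lemma cf_quot_ge1 (R : realType) (x : R) (n : nat) :
  irrational x -> 1 <= cf_quot x n.+1.
Proof.
move=> irr_x; rewrite /cf_quot /= -[1]/(1%:~R : int) floor_ge_int.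
have := cf_rest_frac_gt0 n irr_x; have := frac_part_bounds (cf_rest x n).
by case/andP=> _ l1 l0; rewrite invf_ge1 // ltW.
Qed.

Lemma cf_den_ge1 (R : realType) (x : R) (n : nat) :
  irrational x -> 1 <= cf_den x n.
Proof.
move=> irr_x.
suff : 1 <= cf_den x n /\ 1 <= cf_den x n.+1 by case.
elim: n => [|n [IH1 IH2]]; first by split=> //; apply: cf_quot_ge1.
split=> //; rewrite -[cf_den x n.+2]/(cf_quot x n.+2 * cf_den x n.+1 + cf_den x n).
by have := cf_quot_ge1 n.+1 irr_x; nia.
Qed.

Lemma cf_det (R : realType) (x : R) (n : nat) :
  cf_den x n.+1 * cf_num x n - cf_num x n.+1 * cf_den x n = (-1) ^+ n.+1.
Proof.
elim: n => [|n IH] /=; first by ring.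
by rewrite exprS -IH /=; ring.
Qed.

Definition cf_dev (R : realType) (x : R) (n : nat) : R :=
  (cf_den x n)%:~R * x - (cf_num x n)%:~R.

(** Write [d_n] for the deviations, [r_n] for the complete quotients and [a_n]
    for their integral parts.  By induction [r_{n+2} = - d_n / d_{n+1}], so
    that [d_{n+2} = a_{n+2} d_{n+1} + d_n] equals
    [- (r_{n+2} - a_{n+2}) d_{n+1}]. *)
Lemma cf_devS (R : realType) (x : R) (n : nat) : irrational x ->
  cf_dev x n.+1 = - cf_dev x n * frac_part (cf_rest x n.+1).
Proof.
move=> irr_x.
have step m (f := frac_part (cf_rest x m)) : 0 < f ->
    frac_part (cf_rest x m.+1) = f^-1 - (cf_quot x m.+1)%:~R by [].
elim: n => [|n IH].
  have := cf_rest_frac_gt0 0 irr_x.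
  have ef : frac_part (cf_rest x 0) = x - (cf_quot x 0)%:~R by [].
  rewrite step ef ?subr_gt0; last by rewrite -subr_gt0 -ef cf_rest_frac_gt0.
  rewrite -subr_gt0 => /lt0r_neq0 f0.
  rewrite /cf_dev -[cf_num x 1]/(cf_quot x 1 * cf_quot x 0 + 1).
  rewrite -[cf_den x 1]/(cf_quot x 1) -[cf_den x 0]/1 -[cf_num x 0]/(cf_quot x 0).
  by rewrite rmorphD rmorphM /=; field.
have f0 := cf_rest_frac_gt0 n.+1 irr_x.
rewrite step //.
have -> : cf_dev x n.+2 = (cf_quot x n.+2)%:~R * cf_dev x n.+1 + cf_dev x n.
  by rewrite /cf_dev -[cf_den x n.+2]/(cf_quot x n.+2 * cf_den x n.+1 + cf_den x n)
    -[cf_num x n.+2]/(cf_quot x n.+2 * cf_num x n.+1 + cf_num x n)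
    !rmorphD !rmorphM /=; ring.
have -> : cf_dev x n = - cf_dev x n.+1 / frac_part (cf_rest x n.+1).
  by rewrite IH mulNr mulfK ?opprK // lt0r_neq0.
by field; apply: lt0r_neq0.
Qed.

(** Each step of the recurrence for the deviations multiplies by a negative
    factor, so consecutive convergents lie on alternate sides of [x]. *)
Lemma cf_devE (R : realType) (x : R) (n : nat) : irrational x ->
  0 < cf_err x n /\ cf_dev x n = (-1) ^+ n * cf_err x n.
Proof.
move=> irr_x; have errE m : cf_err x m = `|cf_dev x m| by [].
elim: n => [|n [e0 IH]].
  have f0 : 0 < cf_dev x 0.
    by rewrite /cf_dev /= mul1r; apply: (frac_part_irr_gt0 irr_x).
  by rewrite errE gtr0_norm // mul1r.
have f0 := cf_rest_frac_gt0 n.+1 irr_x.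
have -> : cf_err x n.+1 = cf_err x n * frac_part (cf_rest x n.+1).
  by rewrite !errE cf_devS // normrM normrN [X in _ * X = _]gtr0_norm.
split; first exact: mulr_gt0.
by rewrite cf_devS // IH exprS; ring.
Qed.

Lemma cf_err_gt0 (R : realType) (x : R) (n : nat) :
  irrational x -> 0 < cf_err x n.
Proof. by case/(cf_devE n). Qed.

Lemma cf_err_lt (R : realType) (x : R) (n : nat) :
  irrational x -> cf_err x n.+1 < cf_err x n.
Proof.
move=> irr_x; rewrite /cf_err -!/(cf_dev _ _) cf_devS // normrM normrN.
have f0 := cf_rest_frac_gt0 n.+1 irr_x; rewrite [`|frac_part _|]gtr0_norm //.
rewrite gtr_pMr; first by case/andP: (frac_part_bounds (cf_rest x n.+1)).
exact: (cf_err_gt0 n irr_x).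
Qed.

Lemma cf_err_rec (R : realType) (x : R) (n : nat) : irrational x ->
  cf_err x n = (cf_quot x n.+2)%:~R * cf_err x n.+1 + cf_err x n.+2.
Proof.
move=> irr_x.
have [_ d0] := cf_devE n irr_x; have [_ d1] := cf_devE n.+1 irr_x.
have [_ d2] := cf_devE n.+2 irr_x.
have : cf_dev x n.+2 = (cf_quot x n.+2)%:~R * cf_dev x n.+1 + cf_dev x n.
  by rewrite /cf_dev -[cf_den x n.+2]/(cf_quot x n.+2 * cf_den x n.+1 + cf_den x n)
    -[cf_num x n.+2]/(cf_quot x n.+2 * cf_num x n.+1 + cf_num x n)
    !rmorphD !rmorphM /=; ring.
rewrite d0 d1 d2 !exprS => e; apply: (mulfI (negbT (signr_eq0 R n))).
by move: e; lra.
Qed.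

(** The recurrence for the errors, continued one step back with the value 1
    before [cf_err x 0]. *)
Lemma cf_err0 (R : realType) (x : R) : irrational x ->
  1 = (cf_quot x 1)%:~R * cf_err x 0 + cf_err x 1.
Proof.
move=> irr_x; have [_ d0] := cf_devE 0 irr_x; have [_ d1] := cf_devE 1 irr_x.
move: d0 d1; rewrite /cf_dev /= rmorphD rmorphM /=.
by rewrite expr0 expr1 !mul1r => <- /(congr1 -%R); rewrite mulN1r opprK => <-; ring.
Qed.

Lemma cf_err_le (R : realType) (x : R) (m n : nat) : irrational x ->
  (m <= n)%N -> cf_err x n <= cf_err x m.
Proof.
move=> irr_x; elim: n => [|n IH]; first by rewrite leqn0 => /eqP ->.
rewrite leq_eqVlt ltnS => /orP[/eqP -> //|/IH]; apply: le_trans.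
by apply/ltW/cf_err_lt.
Qed.

(** * Best approximations from below *)

(** The deviation [K x - H] of the lower approximation with denominator
    [K = k_{2s,t}]. *)
Definition mediant_err (R : realType) (x : R) (s : nat) (t : int) : R :=
  cf_err x (2 * s) - t%:~R * cf_err x (2 * s + 1).

Lemma cf_mediant_den_last (R : realType) (x : R) (s : nat) :
  cf_mediant_den x s (cf_quot x (2 * s + 2)) = cf_den x (2 * s.+1).
Proof.
have -> : (2 * s.+1 = (2 * s).+2)%N by lia.
rewrite /cf_mediant_den addn1 addn2.
by rewrite -[RHS]/(cf_quot x (2 * s).+2 * _ + _) addrC.
Qed.

Lemma cf_mediant_den0 (R : realType) (x : R) (s : nat) :
  cf_mediant_den x s 0 = cf_den x (2 * s).
Proof. by rewrite /cf_mediant_den mul0r addr0. Qed.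

Lemma mediant_err0 (R : realType) (x : R) (s : nat) :
  mediant_err x s 0 = cf_err x (2 * s).
Proof. by rewrite /mediant_err mul0r subr0. Qed.

Lemma mediant_err_last (R : realType) (x : R) (s : nat) : irrational x ->
  mediant_err x s (cf_quot x (2 * s + 2)) = cf_err x (2 * s.+1).
Proof.
move=> irr_x; have -> : (2 * s.+1 = (2 * s).+2)%N by lia.
by rewrite /mediant_err addn1 addn2 (cf_err_rec (2 * s) irr_x) addrC addKr.
Qed.

Lemma mediant_err_le (R : realType) (x : R) (s : nat) (t t' : int) :
  irrational x -> t <= t' -> mediant_err x s t' <= mediant_err x s t.
Proof.
move=> irr_x tt'; rewrite lerD2l lerN2 ler_pM2r ?ler_int //.
exact: cf_err_gt0.
Qed.

Lemma mediant_err_gt0 (R : realType) (x : R) (s : nat) (t : int) :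
  irrational x -> t <= cf_quot x (2 * s + 2) -> 0 < mediant_err x s t.
Proof.
move=> irr_x ht; apply: lt_le_trans (mediant_err_le s irr_x ht).
by rewrite mediant_err_last // cf_err_gt0.
Qed.

Lemma mediant_den_lt (R : realType) (x : R) (s : nat) (t t' : int) :
  irrational x -> (cf_mediant_den x s t < cf_mediant_den x s t') = (t < t').
Proof.
move=> irr_x; rewrite ltrD2l ltr_pM2r //.
by have := cf_den_ge1 (2 * s + 1) irr_x; lia.
Qed.

Lemma mediant_den_gt0 (R : realType) (x : R) (s : nat) (t : int) :
  irrational x -> 0 <= t -> 0 < cf_mediant_den x s t.
Proof.
move=> irr_x t0; rewrite /cf_mediant_den.
by have := cf_den_ge1 (2 * s) irr_x; have := cf_den_ge1 (2 * s + 1) irr_x; nia.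
Qed.

Lemma cf_dev_even (R : realType) (x : R) (s : nat) : irrational x ->
  (cf_den x (2 * s))%:~R * x = (cf_num x (2 * s))%:~R + cf_err x (2 * s).
Proof.
move=> irr_x; have [_] := cf_devE (2 * s) irr_x.
by rewrite mul2n -signr_odd odd_double /cf_dev => e; lra.
Qed.

Lemma cf_dev_odd (R : realType) (x : R) (s : nat) : irrational x ->
  (cf_den x (2 * s + 1))%:~R * x
    = (cf_num x (2 * s + 1))%:~R - cf_err x (2 * s + 1).
Proof.
move=> irr_x; have [_] := cf_devE (2 * s + 1) irr_x.
by rewrite addn1 mul2n -signr_odd /= odd_double /cf_dev /= => e; lra.
Qed.

Lemma mediant_dev (R : realType) (x : R) (s : nat) (t : int) : irrational x ->
  (cf_mediant_den x s t)%:~R * x =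
    (cf_num x (2 * s) + t * cf_num x (2 * s + 1))%:~R + mediant_err x s t.
Proof.
move=> irr_x; rewrite /cf_mediant_den !rmorphD !rmorphM /= mulrDl.
by rewrite -mulrA cf_dev_even // cf_dev_odd // /mediant_err; ring.
Qed.

Lemma frac_part_mediant (R : realType) (x : R) (s : nat) (t : int) :
  irrational x -> 0 <= t <= cf_quot x (2 * s + 2) ->
  frac_part ((cf_mediant_den x s t)%:~R * x) = mediant_err x s t.
Proof.
move=> irr_x /andP[t0 ta]; apply: (frac_part_def (mediant_dev s t irr_x)).
rewrite ltW ?mediant_err_gt0 //=.
have le1 : mediant_err x s t <= cf_err x 0.
  apply: le_trans (mediant_err_le s irr_x t0) _.
  by rewrite mediant_err0 cf_err_le.
apply: le_lt_trans le1 _; rewrite [X in _ < X](cf_err0 irr_x).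
have : 1 <= (cf_quot x 1)%:~R :> R by rewrite ler1z cf_quot_ge1.
by have := cf_err_gt0 0 irr_x; have := cf_err_gt0 1 irr_x; nra.
Qed.

Lemma frac_part_cf_den (R : realType) (x : R) (s : nat) :
  irrational x -> frac_part ((cf_den x (2 * s))%:~R * x) = cf_err x (2 * s).
Proof.
move=> irr_x; rewrite -cf_mediant_den0 frac_part_mediant ?mediant_err0 //=.
by rewrite addn2; have := cf_quot_ge1 (2 * s).+1 irr_x; lia.
Qed.

(** The vectors [(k_{2s,t}, H)] and [(k_{2s+1}, h_{2s+1})] form a basis of the
    lattice of integer points and deviate from [x] in opposite directions, by
    [E] and [- e].  The point [(d, floor (d x))] is [u] times the first plus
    [v] times the second, with deviation [u E - v e] in [(0, 1)].  If that
    were less than [E], then either [u <= 0], which forces [v < 0] and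
    [d < 0], or [u >= 1], which forces [v >= 1] and [d >= k_{2s,t+1}]. *)
Lemma mediant_best_lower (R : realType) (x : R) (s : nat) (t d : int) :
  irrational x -> 0 <= t < cf_quot x (2 * s + 2) ->
  0 < d < cf_mediant_den x s (t + 1) ->
  mediant_err x s t <= frac_part (d%:~R * x).
Proof.
move=> irr_x /andP[t0 ta] /andP[d0 dK].
have f0 : 0 < frac_part (d%:~R * x).
  by apply: frac_part_mul_gt0; rewrite // gt_eqF.
have E0 := mediant_err_gt0 irr_x (ltW ta).
have e0 := cf_err_gt0 (2 * s + 1) irr_x.
have K0 := mediant_den_gt0 s irr_x t0.
have k0 := cf_den_ge1 (2 * s + 1) irr_x.
have dev1 := mediant_dev s t irr_x; have dev2 := cf_dev_odd s irr_x.
have det := cf_det x (2 * s).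
rewrite exprS mul2n -signr_odd odd_double mulr1 -mul2n -addn1 in det.
have eK : cf_mediant_den x s (t + 1)
    = cf_mediant_den x s t + cf_den x (2 * s + 1).
  by rewrite /cf_mediant_den; ring.
rewrite eK in dK; have detK : cf_den x (2 * s + 1)
    * (cf_num x (2 * s) + t * cf_num x (2 * s + 1))
    - cf_num x (2 * s + 1) * cf_mediant_den x s t = -1.
  by rewrite -det /cf_mediant_den; ring.
rewrite leNgt; apply/negP => fE.
move: dev1 dev2 detK f0 E0 e0 K0 k0 dK fE {t0 ta eK det}; rewrite /frac_part.
move: (cf_num x (2 * s) + _) => H.
move: (cf_mediant_den _ _ _) (cf_den _ _) (cf_num _ _) (mediant_err _ _ _)
  (cf_err _ _) (Num.floor _) => K k h E e n.
move=> dev1 dev2 det f0 E0 e0 K0 k0 dK fE.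
pose u := d * h - n * k; pose v := K * n - H * d.
have du : d = u * K + v * k.
  (* Cramer's rule: the determinant is -1. *)
  by rewrite -[LHS]mulr1 -[1]opprK -det /u /v; ring.
have nu : n = u * H + v * h.
  by rewrite -[LHS]mulr1 -[1]opprK -det /u /v; ring.
clearbody u v.
have fu : d%:~R * x - n%:~R = u%:~R * E - v%:~R * e.
  have -> : E = K%:~R * x - H%:~R by rewrite dev1; ring.
  have -> : e = h%:~R - k%:~R * x by rewrite dev2; ring.
  by rewrite du nu !rmorphD !rmorphM /=; ring.
rewrite {}fu in f0 fE.
have [u0|u1] := lerP u 0.
  have v0 : v < 0.
    rewrite -(ltrz0 R) -(pmulr_llt0 _ e0); apply: lt_le_trans (_ : u%:~R * E <= 0).
      by move: f0; lra.
    by rewrite pmulr_lle0 // lerz0.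
  by nia.
have v0 : 0 < v.
  rewrite -(ltr0z R) -(pmulr_lgt0 _ e0); apply: le_lt_trans (_ : u%:~R * E - E < _).
    have : 1 <= u%:~R :> R by rewrite ler1z -gtz0_ge1.
    by nra.
  by move: fE; lra.
by nia.
Qed.

(** The intervals from each [k_{2s,t}] to the next one cover the positive
    integers, because the denominators [k_{2s}] grow without bound. *)
Lemma mediant_den_locate (R : realType) (x : R) (d : int) :
  irrational x -> 0 < d -> exists (s : nat) (t : int),
    0 <= t < cf_quot x (2 * s + 2) /\
    cf_mediant_den x s t <= d < cf_mediant_den x s (t + 1).
Proof.
move=> irr_x d0.
have grow s : cf_den x (2 * s) < cf_den x (2 * s.+1).
  rewrite -cf_mediant_den_last -cf_mediant_den0 mediant_den_lt // addn2.
  by have := cf_quot_ge1 (2 * s).+1 irr_x; lia.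
have big (s : nat) : s%:Z < cf_den x (2 * s).
  by elim: s => [//|s IH]; have := grow s; lia.
have ex : exists s : nat, d < cf_den x (2 * s).
  by exists `|d|%N; apply: le_lt_trans (big _); lia.
case: (ex_minnP ex) => -[|s]; first by rewrite muln0 /=; lia.
move=> ds mins.
have sd : cf_den x (2 * s) <= d.
  by rewrite leNgt; apply/negP => /mins; rewrite ltnn.
have k0 := cf_den_ge1 (2 * s + 1) irr_x.
have e := divz_eq (d - cf_den x (2 * s)) (cf_den x (2 * s + 1)).
have r0 : 0 <= ((d - cf_den x (2 * s)) %% cf_den x (2 * s + 1))%Z.
  by apply: modz_ge0; lia.
have r1 : ((d - cf_den x (2 * s)) %% cf_den x (2 * s + 1))%Z
    < cf_den x (2 * s + 1) by apply: ltz_pmod; lia.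
move: e r0 r1; set t := (_ %/ _)%Z; move: (modz _ _) => r e r0 r1.
rewrite -cf_mediant_den_last in ds.
exists s, t; split; last by rewrite /cf_mediant_den; lia.
apply/andP; split; first by nia.
rewrite -(mediant_den_lt s t _ irr_x); apply: le_lt_trans ds.
by rewrite /cf_mediant_den; lia.
Qed.

(** The step [d] of the greedy descent from the level [y]: the least [d] whose
    [{d x}] can be subtracted without making the level negative. *)
Definition first_below (R : realType) (x y : R) (d : int) : Prop :=
  [/\ 0 < d, frac_part (d%:~R * x) <= y
    & forall c : int, 0 < c -> frac_part (c%:~R * x) <= y -> d <= c].

(** The last [k_{2s,t}] up to [d] deviates no more than [d] does, so it also
    fits under [y], and by minimality it is [d]. *)
Lemma first_below_lower_den (R : realType) (x y : R) (d : int) :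
  irrational x -> first_below x y d -> lower_den x d.
Proof.
move=> irr_x [d0 dy mind]; have [s [t [ht hd]]] := mediant_den_locate irr_x d0.
exists s, t; split=> //; apply/eqP; rewrite eq_le; case/andP: (hd) => hd1 hd2.
rewrite hd1 andbT; case/andP: (ht) => t0 ta; apply: mind.
  exact: mediant_den_gt0.
rewrite frac_part_mediant ?t0 ?(ltW ta) //; apply: le_trans dy.
by apply: mediant_best_lower; rewrite ?d0.
Qed.

(** The levels from which the step is [k_{2s,t}] form an interval: not below
    its deviation, and below that of the preceding denominator. *)
Lemma first_below_mediant (R : realType) (x y : R) (s : nat) (t : int) :
  irrational x -> 0 < t <= cf_quot x (2 * s + 2) ->
  first_below x y (cf_mediant_den x s t) ->
  mediant_err x s t <= y < mediant_err x s (t - 1).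
Proof.
move=> irr_x /andP[t0 ta] [_ dy mind]; rewrite frac_part_mediant ?(ltW t0) // in dy.
rewrite dy ltNge /=; apply/negP => hy.
have : cf_mediant_den x s t <= cf_mediant_den x s (t - 1).
  apply: mind; first by apply: mediant_den_gt0 => //; lia.
  by rewrite frac_part_mediant //; lia.
by rewrite leNgt mediant_den_lt //; lia.
Qed.

(** The level exceeds the deviation of [k_{2s,t}] by less than the gap between
    the deviations of [k_{2s,t}] and [k_{2s,t-1}], which is [eps_{2s+1}]. *)
Lemma first_below_mediant_rest (R : realType) (x y : R) (s : nat) (t : int) :
  irrational x -> 0 < t <= cf_quot x (2 * s + 2) ->
  first_below x y (cf_mediant_den x s t) ->
  y - frac_part ((cf_mediant_den x s t)%:~R * x) < cf_err x (2 * s + 1).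
Proof.
move=> irr_x ht hd; have := first_below_mediant irr_x ht hd.
rewrite frac_part_mediant //; last by case/andP: ht => /ltW ->.
by rewrite /mediant_err rmorphB /=; lra.
Qed.

(** Among the [t < a_{2s+2}] the smallest deviation is that of
    [t = a_{2s+2} - 1], which is [eps_{2s+1} + eps_{2s+2}]. *)
Lemma mediant_err_gt_odd (R : realType) (x : R) (s : nat) (t : int) :
  irrational x -> t < cf_quot x (2 * s + 2) ->
  cf_err x (2 * s + 1) < mediant_err x s t.
Proof.
move=> irr_x ta.
have ta1 : t <= cf_quot x (2 * s + 2) - 1 by lia.
apply: lt_le_trans (mediant_err_le s irr_x ta1).
have := mediant_err_last s irr_x; have := cf_err_gt0 (2 * s.+1) irr_x.
by rewrite /mediant_err rmorphB /=; lra.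
Qed.

(** * The exponents as a greedy descent *)

(** The logarithm in base [p] of [m / zeta b], that is, how far the
    approximation [zeta b] remains below [m]. *)
Definition level (R : realType) (p q m b : nat) : R :=
  frac_part (logb p m%:R - b%:R * log_ratio R p q).

Lemma ln_exprz (R : realType) (x : R) (z : int) :
  0 < x -> ln (x ^ z) = z%:~R * ln x.
Proof.
move=> x0; case: z => n; first by rewrite -exprnP lnXn // -[_ *+ n]mulr_natl.
by rewrite NegzE -exprnN lnV ?posrE ?exprn_gt0 // lnXn // -[_ *+ _]mulr_natl rmorphN mulNr.
Qed.

(** In base [p], [log (zeta b)] is [log m] minus the level of [b]. *)
Lemma zeta_lt (R : realType) (p q m b b' : nat) : (1 < p)%N -> (1 < q)%N ->
  (zeta R p q m b < zeta R p q m b') = (level R p q m b' < level R p q m b).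
Proof.
move=> p1 q1.
have p0 : 0 < p%:R :> R by rewrite ltr0n ltnW.
have q0 : 0 < q%:R :> R by rewrite ltr0n ltnW.
have lnp : 0 < ln p%:R :> R by rewrite ln_gt0 // ltr1n.
have zeta_gt0 c : 0 < zeta R p q m c by rewrite mulr_gt0 ?exprz_gt0 ?exprn_gt0.
have ln_zeta c : ln (zeta R p q m c) =
    ln p%:R * (logb p m%:R - level R p q m c).
  rewrite lnM ?posrE ?exprz_gt0 ?exprn_gt0 // ln_exprz // lnXn //.
  rewrite -[ln _ *+ _]mulr_natl.
  rewrite /level /frac_part.
  have {1}-> : ln q%:R = log_ratio R p q * ln p%:R by rewrite divfK // lt0r_neq0.
  by ring.
rewrite -ltr_ln ?posrE // !ln_zeta ltr_pM2l //.
by apply/idP/idP; lra.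
Qed.

Lemma level_sub (R : realType) (p q m b : nat) (d : int) : 0 <= d ->
  level R p q m (b + `|d|)%N =
    frac_part (logb p m%:R - b%:R * log_ratio R p q - d%:~R * log_ratio R p q).
Proof.
move=> d0; rewrite /level natrD -[`|d|%N%:R]/((Posz `|d|%N)%:~R) gez0_abs //.
by congr frac_part; ring.
Qed.

(** Going from [b] to [b + d] subtracts [d rho] before the fractional part is
    taken, so the least [b' > b] with a larger [zeta] is found by the least
    [d] that fits under the level. *)
Lemma next_exponentP (R : realType) (p q m b b' : nat) :
  (1 < p)%N -> (1 < q)%N -> irrational (log_ratio R p q) ->
  next_exponent R p q m b = Some b' <->
  first_below (log_ratio R p q) (level R p q m b) (b'%:Z - b%:Z).
Proof.
move=> p1 q1 irr; set rho := log_ratio R p q in irr *.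
have key c : (b < c)%N -> (zeta R p q m b < zeta R p q m c) =
    (frac_part ((c%:Z - b%:Z)%:~R * rho) <= level R p q m b).
  move=> bc; have -> : c = (b + `|c%:Z - b%:Z|)%N by lia.
  rewrite zeta_lt // level_sub; last by lia.
  rewrite frac_part_sub_lt; last by apply: frac_part_mul_gt0 => //; lia.
  by have -> : (b + `|c%:Z - b%:Z|)%N%:Z - b%:Z = c%:Z - b%:Z by lia.
have minP c : (b < c)%N && (zeta R p q m b < zeta R p q m c) ->
    (forall n, (b < n)%N && (zeta R p q m b < zeta R p q m n) -> (c <= n)%N) ->
    first_below rho (level R p q m b) (c%:Z - b%:Z).
  case/andP=> bc; rewrite key // => hc minc; split=> //; first by lia.
  move=> e e0 he; suff : (c <= b + `|e|)%N by lia.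
  have be : (b < b + `|e|)%N by lia.
  apply: minc; rewrite be key //=.
  by have -> : (b + `|e|)%N%:Z - b%:Z = e by lia.
rewrite /next_exponent; case: pselect => [ex|nex]; split.
- by move=> [<-]; case: ex_minnP => c; apply: minP.
- case: ex_minnP => c hc minc [d0 dy mind]; congr Some.
  have [d0' dy' mind'] := minP c hc minc.
  by have := mind _ d0' dy'; have := mind' _ d0 dy; lia.
- by [].
- move=> [d0 dy mind]; case: nex; have bb' : (b < b')%N by lia.
  by exists b'; rewrite bb' key.
Qed.

Lemma gapP (R : realType) (p q m i : nat) (d : int) :
  (1 < p)%N -> (1 < q)%N -> irrational (log_ratio R p q) ->
  gap R p q m i.+1 = Some d -> exists b b' : nat,
    [/\ exponent R p q m i = Some b, exponent R p q m i.+1 = Some b',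
        first_below (log_ratio R p q) (level R p q m b) d
      & level R p q m b' =
          level R p q m b - frac_part (d%:~R * log_ratio R p q)].
Proof.
move=> p1 q1 irr; rewrite /gap.
case E : (exponent R p q m i) => [b|//].
case E' : (exponent R p q m i.+1) => [b'|//] [<-].
exists b, b'; have /next_exponentP : next_exponent R p q m b = Some b'.
  by move: E'; rewrite /= E.
move=> /(_ p1 q1 irr) hd; split=> //; have [d0 dy _] := hd.
have -> : level R p q m b' = level R p q m (b + `|b'%:Z - b%:Z|)%N.
  by congr level; lia.
by rewrite level_sub ?(ltW d0) // frac_part_sub.
Qed.

Lemma gap_first_below (R : realType) (p q m i b : nat) (d : int) :
  (1 < p)%N -> (1 < q)%N -> irrational (log_ratio R p q) ->
  exponent R p q m i = Some b ->
  first_below (log_ratio R p q) (level R p q m b) d ->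
  gap R p q m i.+1 = Some d.
Proof.
move=> p1 q1 irr E hd; have [d0 _ _] := hd.
have eb : (b + `|d|)%N%:Z - b%:Z = d by lia.
have E' : next_exponent R p q m b = Some (b + `|d|)%N.
  by apply/next_exponentP; rewrite // eb.
by rewrite /gap /= E E' eb.
Qed.

Lemma level_nonincreasing (R : realType) (p q m i j b b' : nat) :
  (1 < p)%N -> (1 < q)%N -> irrational (log_ratio R p q) -> (i <= j)%N ->
  exponent R p q m i = Some b -> exponent R p q m j = Some b' ->
  level R p q m b' <= level R p q m b.
Proof.
move=> p1 q1 irr; elim: j b' => [|j IH] b'.
  by rewrite leqn0 => /eqP -> -> [->].
rewrite leq_eqVlt ltnS => /orP[/eqP -> -> [->] //|ij Ei Ej].
case Ejp : (exponent R p q m j) => [c|]; last by move: Ej; rewrite /= Ejp.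
have G : gap R p q m j.+1 = Some (b'%:Z - c%:Z) by rewrite /gap Ejp Ej.
have [c1 [b1 [E1 E2 _ lev]]] := gapP p1 q1 irr G.
move: E1 E2 lev; rewrite Ejp Ej => -[<-] [<-] ->.
apply: le_trans (IH _ ij Ei Ejp).
by have := frac_part_bounds ((b'%:Z - c%:Z)%:~R * log_ratio R p q); lra.
Qed.

(** A step that fits under the current level also fits under every earlier
    one. *)
Lemma gap_nondecreasing (R : realType) (p q m i j : nat) (x y : int) :
  (1 < p)%N -> (1 < q)%N -> irrational (log_ratio R p q) -> (i <= j)%N ->
  gap R p q m i = Some x -> gap R p q m j = Some y -> x <= y.
Proof.
move=> p1 q1 irr; case: i => [//|i]; case: j => [//|j]; rewrite ltnS => ij Gi Gj.
have [b [_ [Ei _ [_ _ minx] _]]] := gapP p1 q1 irr Gi.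
have [c [_ [Ej _ [y0 yc _] _]]] := gapP p1 q1 irr Gj.
apply: minx => //; apply: le_trans yc _.
exact: (level_nonincreasing p1 q1 irr ij Ei Ej).
Qed.

(** After a step [k_{2s,t}] with [t > 0] the level is below the deviation of
    every [k_{2s,t'}] with [t' < a_{2s+2}]. *)
Lemma gap_mediant_once (R : realType) (p q m i j s : nat) (t t' : int) :
  let rho := log_ratio R p q in
  (1 < p)%N -> (1 < q)%N -> irrational rho ->
  0 < t < cf_quot rho (2 * s + 2) -> 0 < t' < cf_quot rho (2 * s + 2) ->
  gap R p q m i = Some (cf_mediant_den rho s t) ->
  gap R p q m j = Some (cf_mediant_den rho s t') -> (j <= i)%N.
Proof.
move=> rho p1 q1 irr ht ht'; case: i => [//|i]; case: j => [//|j] Gi Gj.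
rewrite leqNgt; apply/negP; rewrite ltnS => ij.
have [b [b1 [_ Ei1 fi lev]]] := gapP p1 q1 irr Gi.
have [c [_ [Ej _ [_ hc _] _]]] := gapP p1 q1 irr Gj.
have := level_nonincreasing p1 q1 irr ij Ei1 Ej; rewrite lev.
have [t0 ta] := andP ht; have [t'0 t'a] := andP ht'.
have := first_below_mediant_rest irr _ fi; rewrite t0 ltW // => /(_ isT).
move: hc; rewrite -/rho frac_part_mediant ?(ltW t'0) ?(ltW t'a) //.
by have := mediant_err_gt_odd irr t'a; lra.
Qed.

(** As long as [k_{2s}] fits under the level it is repeated: the smaller
    denominators did not fit at first, and the level only decreases. *)
Lemma gap_convergent_run (R : realType) (p q m i s b n : nat) :
  let rho := log_ratio R p q in
  (1 < p)%N -> (1 < q)%N -> irrational rho ->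
  exponent R p q m i = Some b ->
  first_below rho (level R p q m b) (cf_den rho (2 * s)) ->
  n%:R * cf_err rho (2 * s) <= level R p q m b ->
  (exists2 c, exponent R p q m (i + n) = Some c &
     level R p q m c = level R p q m b - n%:R * cf_err rho (2 * s)) /\
  forall j, (j < n)%N -> gap R p q m (i + j).+1 = Some (cf_den rho (2 * s)).
Proof.
move=> rho p1 q1 irr Eb [k0 _ mink].
have e0 := cf_err_gt0 (2 * s) irr.
elim: n => [|n IH] hn.
  by split=> //; exists b; rewrite ?addn0 // mul0r subr0.
rewrite -natr1 mulrDl mul1r in hn.
case: IH => [|[c Ec lev] run]; first by lra.
have G : gap R p q m (i + n).+1 = Some (cf_den rho (2 * s)).
  apply: (gap_first_below p1 q1 irr Ec); split=> //.
    by rewrite -/rho frac_part_cf_den // lev; lra.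
  move=> d d0 hd; apply: mink => //; apply: le_trans hd _.
  by rewrite lev gerBl mulr_ge0 // ltW.
split; last first.
  by move=> j; rewrite ltnS leq_eqVlt => /orP[/eqP -> //|]; apply: run.
have [c1 [c' [Ec1 Ec' _ lev']]] := gapP p1 q1 irr G.
exists c'; first by rewrite addnS.
move: Ec1 lev'; rewrite Ec -/rho frac_part_cf_den // => -[<-] ->.
by rewrite lev -natr1; ring.
Qed.

(** * The differences of the sequence *)

Theorem theorem5 (R : realType) (p q m : nat) (hp : (1 < p)%N) (hpq : (p < q)%N)
    (hind : mult_independent p q) (hm : (0 < m)%N) :
  let rho : R := log_ratio R p q in
  let a := cf_quot rho in
  let k := cf_den rho in
  let kk := cf_mediant_den rho in
  let eps := cf_err rho in
  let b := exponent R p q m in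
  let d := gap R p q m in
  let f (bi : nat) : R := frac_part (logb p m%:R - bi%:R * rho) in
  [/\ (* the sequence is non-decreasing *)
      forall (i j : nat) (x y : int),
        (i <= j)%N -> d i = Some x -> d j = Some y -> x <= y,
      (* its terms belong to (K_n) *)
      forall (i : nat) (x : int), d i = Some x -> lower_den rho x,
      (* (i) *)
      (forall (s : nat) (t t' : int),
         0 < t < a (2 * s + 2)%N -> 0 < t' < a (2 * s + 2)%N ->
         (exists i : nat, d i = Some (kk s t)) ->
         (exists i : nat, d i = Some (kk s t')) -> t = t') /\
      (forall (i s : nat) (t : int) (bi : nat),
         0 < t < a (2 * s + 2)%N ->
         b i = Some bi -> d i.+1 = Some (kk s t) ->
         t = Num.ceil ((eps (2 * s)%N - f bi) / eps (2 * s + 1)%N))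
    & (* (ii) *)
      forall (i s bi : nat),
        b i = Some bi -> d i.+1 = Some (k (2 * s)%N) ->
        i = 0%N \/ (exists x : int, d i = Some x /\ x < k (2 * s)%N) ->
        exists n : nat,
          [/\ n%:Z = Num.floor (f bi / eps (2 * s)%N),
              (forall j : nat, (j < n)%N -> d (i + j).+1 = Some (k (2 * s)%N)),
              d (i + n).+1 <> Some (k (2 * s)%N)
            & let after_mediant :=
                s = 0%N \/
                (exists (s' : nat) (t : int), s = s'.+1 /\
                   0 < t < a (2 * s)%N /\ d i = Some (kk s' t)) in
              (after_mediant -> n%:Z <= a (2 * s + 1)%N) /\
              (~ after_mediant -> n%:Z <= 1 + a (2 * s + 1)%N)]].
Proof.
move=> rho a k kk eps b d f.
have hq := ltn_trans hp hpq.
have irr : irrational rho := log_ratio_irrational hp hpq hind.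
split.
- move=> i j x y; exact: gap_nondecreasing.
- move=> [//|i] x /(gapP hp hq irr)[c [_ [_ _ hd _]]].
  exact: first_below_lower_den hd.
- split.
    move=> s t t' ht ht' [i Gi] [j Gj].
    have ij : i = j.
      apply/eqP; rewrite eqn_leq (gap_mediant_once hp hq irr ht' ht Gj Gi).
      exact: (gap_mediant_once hp hq irr ht ht' Gi Gj).
    move: Gj; rewrite -ij Gi => -[e].
    by have := mediant_den_lt s t t' irr; have := mediant_den_lt s t' t irr;
      rewrite -/kk e ltxx; lia.
  move=> i s t bi ht Eb G; have [t0 ta] := andP ht.
  have [c [_ [Ec _ hd _]]] := gapP hp hq irr G.
  move: Ec hd; rewrite -/b Eb => -[<-] hd.
  have := first_below_mediant irr _ hd; rewrite t0 ltW // => /(_ isT).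
  rewrite /mediant_err -/eps -[level _ _ _ _ _]/(f bi) rmorphB /= => hy.
  apply/esym/ceil_def; rewrite ltr_pdivlMr ?ler_pdivrMr ?cf_err_gt0 //.
  by rewrite rmorphB /=; lra.
- move=> i s bi Eb G _.
  have [c [_ [Ec _ hd _]]] := gapP hp hq irr G.
  move: Ec hd; rewrite -/b Eb => -[<-] {c} hd.
  have e0 : 0 < eps (2 * s)%N := cf_err_gt0 (2 * s) irr.
  have f0 : 0 <= f bi by case/andP: (frac_part_bounds (logb p m%:R - bi%:R * rho)).
  have fl : Num.floor (f bi / eps (2 * s)%N) = `|Num.floor (f bi / eps (2 * s)%N)|%N.
    by rewrite gez0_abs // floor_ge0 divr_ge0 // ltW.
  move: fl; set n := absz _ => fl; clearbody n; exists n.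
  have := floor_itv (f bi / eps (2 * s)%N).
  rewrite fl ler_pdivlMr // ltr_pdivrMr // => /andP[nle].
  rewrite rmorphD /= mulrDl mul1r => nlt.
  have [[c Ec lev] run] := gap_convergent_run hp hq irr Eb hd nle.
  have small (y : int) : f bi < y%:~R * eps (2 * s)%N -> n%:Z < y.
    by move=> hy; rewrite -(ltr_int R) -(ltr_pM2r e0); apply: le_lt_trans hy.
  split=> //.
    move=> G'; have [c' [_ [Ec' _ [_ hk _] _]]] := gapP hp hq irr G'.
    move: Ec' hk; rewrite Ec -/rho => -[<-].
    by rewrite frac_part_cf_den // lev -/rho; move: nlt; rewrite /eps /f /level; lra.
  have lastE s' : (2 * s'.+1 = 2 * s' + 2)%N by lia.
  have errE s' : eps (2 * s' + 1)%N =
      (a (2 * s'.+1 + 1)%N)%:~R * eps (2 * s'.+1)%N + eps (2 * s'.+1 + 1)%N.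
    rewrite lastE addn2 !addn1; exact: (cf_err_rec _ irr).
  have errlt s' : eps (2 * s' + 1)%N < eps (2 * s')%N.
    by rewrite addn1; exact: cf_err_lt.
  split=> [[s0|[s' [t [es [ht G']]]]]|nmed].
  (* [s = 0]: the level is less than [1 = a_1 eps_0 + eps_1]. *)
  + suff : n%:Z < a (2 * s + 1)%N + 1 by lia.
    apply: small; rewrite rmorphD /= mulrDl mul1r.
    have := cf_err0 irr; have := errlt s; rewrite s0 muln0 add0n -/eps -/a.
    by have := frac_part_bounds (logb p m%:R - bi%:R * rho); rewrite -/(f bi); lra.
  (* The mediant step left the level below [eps_{2s-1}]. *)
  + case: i {G} Eb Ec run G' => [//|i] Eb _ _ G'.
    have [c1 [b1 [_ Eb1 hd1 lev1]]] := gapP hp hq irr G'.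
    move: Eb1 lev1; rewrite -/b Eb => -[<-] lev1.
    rewrite es lastE in ht; have [t0 ta] := andP ht.
    have := first_below_mediant_rest irr _ hd1; rewrite t0 ltW // => /(_ isT).
    rewrite -lev1 -/eps -[level _ _ _ _ _]/(f bi) errE -es => hf.
    suff : n%:Z < a (2 * s + 1)%N + 1 by lia.
    by apply: small; rewrite rmorphD /= mulrDl mul1r; have := errlt s; lra.
  + have [s0|[s' es]] : s = 0%N \/ exists s', s = s'.+1.
    - by case: (s); [left | right; eexists].
    - by case: nmed; left.
    rewrite {}es in hd small *.
    (* Read as [k_{2s',t}] with [t = a_{2s'+2}], the step [k_{2s}] is preceded
       by the last mediant, or by [k_{2s'}] if there is none; that one does
       not fit under the level. *)
    have hd1 : first_below rho (f bi) (kk s' (a (2 * s' + 2)%N)).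
      by rewrite /kk cf_mediant_den_last.
    have := first_below_mediant irr _ hd1; rewrite lexx andbT.
    have a1 : 0 < a (2 * s' + 2)%N by rewrite addn2; exact: cf_quot_ge1.
    move=> /(_ a1) /andP[_].
    have := mediant_err_last s' irr; rewrite -/a -/eps /mediant_err -/eps rmorphB /=.
    have := errE s'; have := errlt s'.+1 => l1 l2 l3 l4.
    suff : n%:Z < 1 + a (2 * s'.+1 + 1)%N + 1 by lia.
    by apply: small; rewrite !rmorphD /= !mulrDl !mul1r; lra.
Qed.
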